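(* Let $x_0,y_0\in\mathbb{R}^n$ be distinct and suppose $u\in \mathcal{D}^{1,p}(\mathbb{R}^n)$ is an extremal with $$[u]_{C^{1-n/p}(\mathbb{R}^n)}=\frac{|u(x_0)-u(y_0)|}{|x_0-y_0|^{1-n/p}}.$$ Then $$u\left(x -2\frac{(x_0-y_0)\cdot \left(x-\frac{1}{2}(x_0+y_0)\right)}{|x_0-y_0|^2}(x_0-y_0)\right)-\frac{u(x_0)+u(y_0)}{2}=-\left(u(x)-\frac{u(x_0)+u(y_0)}{2}\right)$$ for each $x\in \mathbb{R}^n$.
   Context: Throughout, $n\ge 1$ is an integer and $n<p<\infty$. $\mathcal{D}^{1,p}(\mathbb{R}^n)$ is the space of $u\in L^1_{\mathrm{loc}}(\mathbb{R}^n)$ whose weak first-order partial derivatives all belong to $L^p(\mathbb{R}^n)$. Every such $u$ has a Hölder continuous representative and is always identified with it. Put $[u]_{C^{1-n/p}(\mathbb{R}^n)}:=\sup_{x\ne y}\frac{|u(x)-u(y)|}{|x-y|^{1-n/p}}$ and $\|Du\|_{L^p(\mathbb{R}^n)}:=\left(\int_{\mathbb{R}^n}|Du|^p\,dx\right)^{1/p}$. Morrey's inequality says there is a finite constant $C$ with $[u]_{C^{1-n/p}(\mathbb{R}^n)}\le C\|Du\|_{L^p(\mathbb{R}^n)}$ for all $u\in\mathcal{D}^{1,p}(\mathbb{R}^n)$; $C_*$ denotes the sharp (smallest) such constant. An extremal is a function $u\in\mathcal{D}^{1,p}(\mathbb{R}^n)$ with $[u]_{C^{1-n/p}(\mathbb{R}^n)}=C_*\|Du\|_{L^p(\mathbb{R}^n)}$.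 *)

(* Defs.v *)
From HB Require Import structures.
From mathcomp Require Import all_boot all_order all_algebra.
From mathcomp Require Import all_classical all_reals all_analysis.
Set Implicit Arguments.
Unset Strict Implicit.
Unset Printing Implicit Defensive.
Import Order.TTheory GRing.Theory Num.Def Num.Theory.
Import numFieldNormedType.Exports.

Local Open Scope classical_set_scope.
Local Open Scope ring_scope.

(* R^n is 'rV[R]_n, for which the library has the topology and the derivatives
   but no sigma-algebra.  The one below is generated by the coordinates: it is
   the Borel sigma-algebra. *)

Section measurable_rV.
Variables (R : realType) (n : nat).

Definition coord_rV (i : 'I_n) (x : 'rV[R]_n) : measurableTypeR R := x ord0 i.

Let rV_set0 : g_sigma_preimage coord_rV set0.
Proof. exact: sigma_algebra0. Qed.

Let rV_setC A : g_sigma_preimage coord_rV A -> g_sigma_preimage coord_rV (~` A).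
Proof. exact: sigma_algebraC. Qed.

Let rV_bigcup (F : (set 'rV[R]_n)^nat) :
  (forall i, g_sigma_preimage coord_rV (F i)) ->
  g_sigma_preimage coord_rV (\bigcup_i F i).
Proof. exact: sigma_algebra_bigcup. Qed.

HB.instance Definition _ := @isMeasurable.Build default_measure_display
  'rV[R]_n (g_sigma_preimage coord_rV) rV_set0 rV_setC rV_bigcup.

Lemma measurable_coord_rV i : measurable_fun [set: 'rV[R]_n] (coord_rV i).
Proof.
move=> _ Y mY; rewrite setTI; apply: sub_sigma_algebra => /=.
rewrite -bigcup_seq/=; exists i => /=; first by rewrite mem_index_enum.
by exists Y => //; rewrite setTI.
Qed.

Lemma measurable_fun_rV d (T : measurableType d) (f : T -> 'rV[R]_n) :
  (forall i, measurable_fun [set: T] (coord_rV i \o f)) ->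
  measurable_fun [set: T] f.
Proof.
move=> mf _ Y mY; rewrite setTI.
suff: g_sigma_preimage coord_rV `<=` [set B | measurable (f @^-1` B)].
  exact.
apply: smallest_sub.
- split => /=.
  + by rewrite preimage_set0.
  + by move=> A mA; rewrite setTD preimage_setC; exact: measurableC.
  + by move=> F mF; rewrite preimage_bigcup; exact: bigcup_measurable.
- rewrite -bigcup_seq => B [i _ [A mA <-]] /=; rewrite setTI.
  by rewrite -comp_preimage -[X in measurable X]setTI; exact: mf.
Qed.

End measurable_rV.

(* n-dimensional Lebesgue measure, by recursion on n: on R^(n+1) it is the image
   of the product measure under the identification of R * R^n with R^(n+1). *)

Section lebesgue_rV.
Variable R : realType.

Section cons.
Variable n : nat.

Definition cons_rV (z : measurableTypeR R * 'rV[R]_n) : 'rV[R]_n.+1 :=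
  \row_i (if unlift ord0 i is Some j then z.2 ord0 j else z.1).

Definition uncons_rV (x : 'rV[R]_n.+1) : measurableTypeR R * 'rV[R]_n :=
  (x ord0 ord0, \row_j x ord0 (lift ord0 j)).

Lemma cons_rVK : cancel cons_rV uncons_rV.
Proof.
move=> [a v]; congr (_, _); first by rewrite mxE unlift_none.
by apply/rowP => j; rewrite !mxE liftK.
Qed.

Lemma uncons_rVK : cancel uncons_rV cons_rV.
Proof.
move=> x; apply/rowP => i; rewrite mxE.
by case: unliftP => [j|] ->; rewrite ?mxE.
Qed.

Lemma measurable_cons_rV : measurable_fun setT cons_rV.
Proof.
apply: measurable_fun_rV => i.
case: (unliftP ord0 i) => [j ->|->].
- rewrite (_ : _ \o _ = coord_rV j \o snd).
    by apply: measurableT_comp => //; exact: measurable_coord_rV.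
  by apply/funext => z; rewrite /coord_rV /= mxE liftK.
- rewrite (_ : _ \o _ = fst) //.
  by apply/funext => z; rewrite /coord_rV /= mxE unlift_none.
Qed.

Lemma measurable_uncons_rV : measurable_fun setT uncons_rV.
Proof.
apply/measurable_fun_pairP; split; first exact: (measurable_coord_rV ord0).
apply: measurable_fun_rV => j.
rewrite (_ : _ \o _ = coord_rV (lift ord0 j)); first exact: measurable_coord_rV.
by apply/funext => x; rewrite /coord_rV /= mxE.
Qed.

Variable mu : {sigma_finite_measure set 'rV[R]_n -> \bar R}.

Definition cons_measure : set 'rV[R]_n.+1 -> \bar R :=
  pushforward (lebesgue_measure \x mu)%E cons_rV.

Let cons_measure0 : cons_measure set0 = 0%E.
Proof. by rewrite /cons_measure /pushforward preimage_set0 measure0. Qed.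

Let cons_measure_ge0 A : (0 <= cons_measure A)%E.
Proof. by rewrite /cons_measure /pushforward measure_ge0. Qed.

Let cons_measure_sigma_additive : semi_sigma_additive cons_measure.
Proof.
move=> F mF tF mUF; rewrite /cons_measure /pushforward preimage_bigcup.
have mpre A : measurable A -> measurable (cons_rV @^-1` A).
  by move=> mA; rewrite -[X in measurable X]setTI; exact: measurable_cons_rV.
apply: measure_semi_sigma_additive.
- by move=> k; exact: mpre.
- apply/trivIsetP => /= i j _ _ ij; rewrite -preimage_setI.
  by move/trivIsetP : tF => /(_ _ _ _ _ ij) ->//; rewrite preimage_set0.
- by rewrite -preimage_bigcup; exact: mpre.
Qed.

HB.instance Definition _ := isMeasure.Build _ _ _ cons_measure
  cons_measure0 cons_measure_ge0 cons_measure_sigma_additive.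

Let cons_measure_sigma_finite : sigma_finite setT cons_measure.
Proof.
have [F [UF mF]] : exists F : (set (measurableTypeR R * 'rV[R]_n))^nat,
    setT = \bigcup_k F k /\
    forall k, measurable (F k) /\ ((lebesgue_measure \x mu)%E (F k) < +oo)%E.
  have /sigma_finiteP[F [TF ndF Foo]] := sigma_finiteT (@lebesgue_measure R).
  have /sigma_finiteP[G [TG ndG Goo]] := sigma_finiteT mu.
  exists (fun k => F k `*` G k); split.
    rewrite -setXTT TF TG predeqE => -[x y]; split.
      move=> [/= [k _ Fkx] [l _ Gly]]; exists (maxn k l) => //; split.
      - by move: x Fkx; exact/subsetPset/ndF/leq_maxl.
      - by move: y Gly; exact/subsetPset/ndG/leq_maxr.
    by move=> [k _ []/= ? ?]; split; exists k.
  move=> k; have [? ?] := Foo k; have [? ?] := Goo k.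
  split; first exact: measurableX.
  by rewrite product_measure1E// lte_mul_pinfty// ge0_fin_numE.
exists (fun k => uncons_rV @^-1` F k).
  by rewrite -preimage_bigcup -UF preimage_setT.
move=> k; have [mFk Fk] := mF k; split.
  by rewrite -[X in measurable X]setTI; exact: measurable_uncons_rV.
rewrite /cons_measure /pushforward -comp_preimage.
by rewrite (_ : uncons_rV \o cons_rV = id)//; apply/funext => z; exact: cons_rVK.
Qed.

HB.instance Definition _ := Measure_isSigmaFinite.Build _ _ _ cons_measure
  cons_measure_sigma_finite.

End cons.

Fixpoint lebesgue_rV n : {sigma_finite_measure set 'rV[R]_n -> \bar R} :=
  if n is m.+1 then cons_measure (lebesgue_rV m) else \d_(0 : 'rV[R]_0).

Lemma lebesgue_rV_box n (A : 'I_n -> set (measurableTypeR R)) :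
  (forall i, measurable (A i)) ->
  lebesgue_rV n [set x | forall i, A i (x ord0 i)] =
  (\prod_(i < n) lebesgue_measure (A i))%E.
Proof.
elim: n A => [|n IH] A mA.
  rewrite big_ord0 /= diracE mem_set//= => -[].
  by [].
rewrite big_ord_recl -(IH (fun i => A (lift ord0 i)))//.
rewrite /= /cons_measure /pushforward.
rewrite -product_measure1E//.
  congr (product_measure1 _ _ _); apply/seteqP; split => -[a v] /=.
    move=> H; split => [|j].
      by have := H ord0; rewrite mxE unlift_none.
    by have := H (lift ord0 j); rewrite mxE liftK.
  move=> [Ha Hv] i; rewrite mxE; case: unliftP => [j ->|->] //=.
rewrite (_ : (fun x : 'rV[R]_n => _) = \bigcap_(i in [set: 'I_n])
    (coord_rV i @^-1` A (lift ord0 i))); last first.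
  by apply/seteqP; split => x /= H i => [_|]; exact: H.
apply: fin_bigcap_measurable => // i _.
by rewrite -[X in measurable X]setTI; exact: measurable_coord_rV.
Qed.

End lebesgue_rV.

Section morrey.
Variables (R : realType) (n : nat).
Implicit Types (x y : 'rV[R]_n) (u phi : 'rV[R]_n -> R)
  (Du : 'rV[R]_n -> 'rV[R]_n) (p : R).

Local Notation leb := (lebesgue_rV R n).

(* The library norm `|x| on 'rV[R]_n is the sup norm, hence enorm. *)
Definition dotv x y : R := \sum_(i < n) x ord0 i * y ord0 i.

Definition enorm x : R := Num.sqrt (dotv x x).

Definition partial (i : 'I_n) phi : 'rV[R]_n -> R :=
  fun x => 'D_(delta_mx ord0 i) phi x.

(* C^infty: partial derivatives of all orders are (Frechet) differentiable. *)
Definition smooth phi : Prop :=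
  forall (s : seq 'I_n) x, differentiable (foldr partial phi s) x.

Definition test_function phi : Prop :=
  smooth phi /\ compact (closure [set x | phi x != 0]).

Definition locally_integrable_rV u : Prop :=
  measurable_fun [set: 'rV[R]_n] u /\
  forall K : set 'rV[R]_n, compact K -> (\int[leb]_(x in K) `|u x|%:E < +oo)%E.

Definition weak_partial (i : 'I_n) u (g : 'rV[R]_n -> R) : Prop :=
  locally_integrable_rV g /\
  forall phi, test_function phi ->
    (\int[leb]_x (u x * partial i phi x)%:E =
     - \int[leb]_x (g x * phi x)%:E)%E.

(* u belongs to D^{1,p}(R^n), and Du is (a version of) its weak gradient, which
   is unique up to null sets.  Continuity of u says that u is identified with
   its continuous representative. *)
Definition D1p_grad p u Du : Prop :=
  [/\ continuous u, locally_integrable_rV u &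
      forall i, weak_partial i u (fun x => Du x ord0 i) /\
                (fun x => Du x ord0 i) \in Lfun leb p%:E].

Definition grad_norm p Du : \bar R := 'N[leb]_(p%:E)[EFin \o (enorm \o Du)].

Definition holder_quotient p u x y : R :=
  `|u x - u y| / enorm (x - y) `^ (1 - n%:R / p).

Definition holder_seminorm p u : \bar R :=
  ereal_sup [set (holder_quotient p u z.1 z.2)%:E |
             z in [set z : 'rV[R]_n * 'rV[R]_n | z.1 != z.2]].

(* C_*; Morrey's inequality is the fact that this infimum is over a nonempty
   set, and it is then attained. *)
Definition morrey_constant p : \bar R :=
  ereal_inf [set C%:E | C in [set C : R |
    forall u Du, D1p_grad p u Du ->
      (holder_seminorm p u <= C%:E * grad_norm p Du)%E]].

Definition extremal p u : Prop :=
  exists2 Du, D1p_grad p u Du &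
    holder_seminorm p u = (morrey_constant p * grad_norm p Du)%E.

End morrey.

(* Main.v *)
(* Let T be the reflection exchanging x0 and y0.  The function
   w = (u - u o T) / 2 satisfies w x0 - w y0 = u x0 - u y0, so
     C_* |Dw|_p >= [w] >= [u] = C_* |Du|_p,
   while T preserves Lebesgue measure, whence D(u o T) has the same L^p norm as
   Du.  By strict convexity of |.|^p, Du = - D(u o T) almost everywhere.  Then
   u + u o T has gradient of norm 0, and Morrey's inequality, applied to it,
   makes it constant, equal to its value u x0 + u y0 at x0.

   T preserves Lebesgue measure because two sigma-finite translation invariant
   measures mu and nu satisfy mu(A) nu(B) = mu(B) nu(-A) by Fubini; take nu the
   Lebesgue measure, mu its image under the linear part of T, and B the unit
   ball. *)
From HB Require Import structures.
Require Import Defs.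
From mathcomp Require Import all_boot all_order all_algebra.
From mathcomp Require Import all_classical all_reals all_analysis
  measurable_realfun.
From mathcomp Require Import ring lra.
Set Implicit Arguments.
Unset Strict Implicit.
Unset Printing Implicit Defensive.
Import Order.TTheory GRing.Theory Num.Theory.
Import numFieldNormedType.Exports.
Local Open Scope classical_set_scope.
Local Open Scope ring_scope.

(** * Borel sets of [R^n] *)

Section borel_rV.
Variables (R : realType) (n : nat).
Implicit Types (A K : set 'rV[R]_n) (f : 'rV[R]_n -> R).

Lemma measurable_box_rV (B : 'I_n -> set (measurableTypeR R)) :
  (forall i, measurable (B i)) ->
  measurable [set x : 'rV[R]_n | forall i, B i (x ord0 i)].
Proof.
move=> mB; rewrite (_ :
  mkset _ = \bigcap_(i in [set: 'I_n]) (coord_rV i @^-1` B i)).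
  apply: fin_bigcap_measurable => // i _; rewrite -[X in measurable X]setTI.
  exact: measurable_coord_rV.
by apply/seteqP; split => x /= H i => [_|]; exact: H.
Qed.

Let dist_lt (x y q r e : R) : r < e / 2 -> x - r < q -> q < x + r ->
  q - r < y -> y < q + r -> `|x - y| < e.
Proof. by move=> *; rewrite ltr_norml; apply/andP; split; lra. Qed.

(** An open set is the union of the cubes it contains with rational centre and half-side [1/(k+1)],
    and there are only countably many of these. *)
Lemma open_measurable_rV A : open A -> measurable A.
Proof.
move=> oA.
pose box (z : 'rV[rat]_n * nat) := [set y : 'rV[R]_n |
  forall i, `]ratr (z.1 ord0 i) - z.2.+1%:R^-1,
    ratr (z.1 ord0 i) + z.2.+1%:R^-1[%classic (y ord0 i)].
(* Cubes that are not inside [A] are replaced by [set0], so that the union runs over a whole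
   countable type. *)
rewrite (_ : A = \bigcup_z (if `[< box z `<=` A >] then box z else set0)).
  apply: (countable_bigcupT_measurable (U := ('rV[rat]_n * nat)%type)) => [|z].
    exact: countableP.
  case: ifP => // _.
  exact: (@measurable_box_rV (fun i => `]ratr (z.1 ord0 i) - z.2.+1%:R^-1,
    ratr (z.1 ord0 i) + z.2.+1%:R^-1[%classic)).
apply/seteqP; split => [x Ax|x [z _]]; last by case: ifPn => // /asboolP; apply.
have /nbhs_ballP[e /= e0 eA] : nbhs x A by exact: open_nbhs_nbhs.
(* Two radii must fit into [e]: from [x] to the rational centre, and from that centre to any point
   of the cube. *)
have [k ke] : exists k : nat, k.+1%:R^-1 < e / 2.
  have e20 : 0 < e / 2 by rewrite divr_gt0.
  by have [k _ kP] := near_infty_natSinv_lt (PosNum e20); exists k;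
    exact: (kP k (leqnn k)).
have k0 : 0 < k.+1%:R^-1 :> R by rewrite invr_gt0.
have /choice[q qP] : forall i : 'I_n, exists q : rat,
    ratr q \in `](x ord0 i - k.+1%:R^-1), (x ord0 i + k.+1%:R^-1)[.
  by move=> i; apply: rat_in_itvoo; rewrite ltrD2l gtrN.
exists (\row_i q i, k) => //.
rewrite asboolT; last first.
  move=> y yb; apply: eA; split => // i j; rewrite (ord1 i).
  have : y ord0 j \in `](ratr (q j) - k.+1%:R^-1), (ratr (q j) + k.+1%:R^-1)[.
    by have := yb j; rewrite /= mxE.
  have := qP j; rewrite !in_itv /= => /andP[? ?] /andP[? ?].
  rewrite /ball /=; apply:
    (@dist_lt (x ord0 j) (y ord0 j) (ratr (q j)) k.+1%:R^-1) => //.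
move=> i; have := qP i; rewrite /= !in_itv /= mxE => /andP[? ?].
by apply/andP; split; rewrite ?ltrBlDr // -ltrBlDr.
Qed.

Lemma closed_measurable_rV A : closed A -> measurable A.
Proof.
by move=> cA; rewrite -[A]setCK; apply: measurableC; apply: open_measurable_rV;
  exact: closed_openC.
Qed.

Lemma compact_measurable_rV K : compact K -> measurable K.
Proof.
by move=> cK; apply: closed_measurable_rV; apply: compact_closed => //;
  exact: norm_hausdorff.
Qed.

Lemma continuous_measurable_rV f : continuous f -> measurable_fun setT f.
Proof.
move=> cf; apply: (measurability _ (RGenOInfty.measurableE R)) =>
  _ [_ [a ->] <-].
rewrite setTI; apply: open_measurable_rV; move/continuousP: cf; apply.
exact: interval_open.
Qed.

End borel_rV.

(** * Invariance of Lebesgue measure under translations and isometries *)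

Lemma measurable_preimageT d1 d2 (T1 : measurableType d1)
    (T2 : measurableType d2) (f : T1 -> T2) (A : set T2) :
  measurable_fun setT f -> measurable A -> measurable (f @^-1` A).
Proof. by move=> mf mA; rewrite -[X in measurable X]setTI; exact: mf. Qed.

Lemma continuous_measurable_rV2 (R : realType) m n (f : 'rV[R]_m -> 'rV[R]_n) :
  continuous f -> measurable_fun setT f.
Proof.
move=> cf; apply: measurable_fun_rV => i.
apply: (@continuous_measurable_rV R m (fun x => f x ord0 i)) => x.
exact: (continuous_comp (cf x) (@coord_continuous R 1 n ord0 i (f x))).
Qed.

(** The image of Lebesgue measure under a translation gives half-open intervals their length, which
    characterises Lebesgue measure. *)
Lemma lebesgue_measure_shift (R : realType) (t : R)
    (A : set (measurableTypeR R)) : measurable A ->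
  lebesgue_measure ((fun x => x + t : measurableTypeR R) @^-1` A) =
  lebesgue_measure A.
Proof.
pose shift_t (x : measurableTypeR R) : measurableTypeR R := x + t.
have mt : measurable_fun setT shift_t by exact: measurable_funD.
move=> mA; rewrite -[LHS]/(pushforward lebesgue_measure shift_t A).
apply/esym/lebesgue_measure_unique => //= _ [[a b]] _ <-.
rewrite /pushforward (_ : _ @^-1` _ = `]a - t, b - t]%classic).
  by rewrite !lebesgue_measure_itv /= !lte_fin ltrD2r; case: ifP => // _;
    congr (_%:E); ring.
by apply/seteqP; split => x /=; rewrite !in_itv /= ltrBlDr lerBrDr.
Qed.

Section shift.
Variable R : realType.

Lemma measurable_shift_rV n (t : 'rV[R]_n) :
  measurable_fun [set: 'rV[R]_n] (fun x => x + t : 'rV[R]_n).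
Proof.
apply: continuous_measurable_rV2 => x.
have cx : {for x, continuous (id : 'rV[R]_n -> 'rV[R]_n)} by exact: cvg_id.
have ct : {for x, continuous (cst t : 'rV[R]_n -> 'rV[R]_n)}.
  exact: cst_continuous.
exact: (@continuousD R 'rV[R]_n 'rV[R]_n id (cst t) x cx ct).
Qed.

(** By induction on the dimension: a translation of [R^(n+1)] acts separately on the factors of
    [R * R^n], so it is enough to compare measures on rectangles. *)
Lemma lebesgue_rV_shift n (t : 'rV[R]_n) A : measurable A ->
  lebesgue_rV R n ((fun x : 'rV[R]_n => x + t) @^-1` A) = lebesgue_rV R n A.
Proof.
elim: n t A => [|n IH] t A mA.
  congr (lebesgue_rV R 0 _); apply/seteqP; split => x /=;
  by rewrite (_ : x + t = x)//; apply/rowP => -[].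
rewrite /= /cons_measure /pushforward.
pose tau (z : measurableTypeR R * 'rV[R]_n) : measurableTypeR R * 'rV[R]_n :=
  (z.1 + t ord0 ord0, z.2 + \row_j t ord0 (lift ord0 j)).
have mtau : measurable_fun setT tau.
  apply/measurable_fun_pairP; split.
    by apply: measurable_funD => //; exact: measurable_fst.
  exact: (measurableT_comp
    (@measurable_shift_rV n (\row_j t ord0 (lift ord0 j))) measurable_snd).
rewrite (_ : _ @^-1` _ = tau @^-1` (@cons_rV R n @^-1` A)); last first.
  apply/seteqP; split => -[a v];
    rewrite /= (_ : cons_rV _ + t = cons_rV (tau (a, v)))//;
  by apply/rowP => i; rewrite !mxE; case: unliftP => [j ->|->]; rewrite ?mxE.
rewrite -[LHS]/(pushforward (lebesgue_measure \x lebesgue_rV R n)%E tau _).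
apply/esym/product_measure_unique => //; last first.
  by apply: measurable_preimageT mA; exact: measurable_cons_rV.
move=> B C mB mC.
rewrite [LHS](_ : _ = (lebesgue_measure \x lebesgue_rV R n)%E
  (((fun x => x + t ord0 ord0 : measurableTypeR R) @^-1` B) `*`
  ((fun x : 'rV[R]_n => x + \row_j t ord0 (lift ord0 j)) @^-1` C)))//.
rewrite product_measure1E//; last 2 first.
- by apply: measurable_preimageT mB; exact: measurable_funD.
- by apply: measurable_preimageT mC; exact: measurable_shift_rV.
by congr (_ * _)%E; [exact: lebesgue_measure_shift|exact: IH].
Qed.

End shift.

(** * Comparison of two translation invariant measures *)

Definition shift_invariant (R : realType) n (mu : set 'rV[R]_n -> \bar R) :=
  forall (t : 'rV[R]_n) A, measurable A ->
    mu ((fun x : 'rV[R]_n => x + t) @^-1` A) = mu A.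

Section haar.
Variables (R : realType) (n : nat).
Local Notation V := 'rV[R]_n.
Variables (mu nu : {sigma_finite_measure set 'rV[R]_n -> \bar R}).
Hypotheses (imu : shift_invariant mu) (inu : shift_invariant nu).

Lemma measurable_add_rV :
  measurable_fun [set: (V * V)%type] (fun z => z.1 + z.2 : V).
Proof.
apply: measurable_fun_rV => i.
rewrite (_ : _ \o _ = fun z : V * V =>
  (@coord_rV R n i z.1 : R) + (coord_rV i z.2 : R)); last first.
  by apply/funext => z; rewrite /coord_rV /= mxE.
apply: measurable_funD.
  exact: (measurableT_comp (@measurable_coord_rV R n i) measurable_fst).
exact: (measurableT_comp (@measurable_coord_rV R n i) measurable_snd).
Qed.

Lemma measurable_opp_rV : measurable_fun [set: V] (fun z => - z : V).
Proof.
apply: measurable_fun_rV => i.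
rewrite (_ : _ \o _ = fun z : V => - (@coord_rV R n i z : R)); last first.
  by apply/funext => z; rewrite /coord_rV /= mxE.
apply: measurable_funN.
exact: measurable_coord_rV.
Qed.

(** The sections of [E] over points of [A] are translates of [B]. A measure-preserving shear turns
    [E] into [E'], whose sections over points of [B] are translates of [-A]. *)
Lemma shift_invariant_swap A B : measurable A -> measurable B ->
  (mu A * nu B = mu B * nu ((fun x : V => (- x)%R) @^-1` A))%E.
Proof.
move=> mA mB.
pose E := [set z : V * V | A z.1 /\ B (z.1 + z.2)].
pose E' := [set z : V * V | B z.1 /\ A (z.1 - z.2)].
have mE : measurable E.
  rewrite (_ : E = (fst @^-1` A) `&` ((fun z : V * V => z.1 + z.2) @^-1` B))//.
  apply: measurableI; apply: measurable_preimageT => //.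
  exact: measurable_add_rV.
have mE' : measurable E'.
  rewrite (_ : E' = (fst @^-1` B) `&` ((fun z : V * V => z.1 - z.2) @^-1` A))//.
  apply: measurableI; apply: measurable_preimageT => //.
  rewrite (_ : (fun z : V * V => z.1 - z.2) = (fun z => z.1 + z.2) \o
    (fun z => (z.1, - z.2)))//.
  apply: measurableT_comp; first exact: measurable_add_rV.
  apply/measurable_fun_pairP; split; first exact: measurable_fst.
  exact: (measurableT_comp measurable_opp_rV measurable_snd).
(* Tonelli for sets: integrating the measures of vertical or of horizontal sections gives the same
   result. *)
have p12 F : measurable F -> (mu \x nu)%E F = (mu \x^ nu)%E F.
  by move=> mF; apply: product_measure_unique => //= C D mC mD;
    rewrite product_measure2E.
transitivity ((mu \x nu)%E E).
  rewrite /product_measure1 /=.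
  rewrite (eq_integral (fun x => (\1_A x)%:E * nu B)%E); last first.
    move=> x _ /=; rewrite indicE; have [xA|xA] := boolP (x \in A).
      rewrite mul1e -(inu x mB); congr (nu _); apply/seteqP; split => y;
      rewrite /xsection /= ?inE /E /= addrC; first by case.
      by split => //; exact: set_mem.
    rewrite mul0e (_ : xsection E x = set0) ?measure0//.
    apply/seteqP; split => y //; rewrite /xsection /= inE /E /= => -[xA' _].
    by move: xA; rewrite mem_set.
  rewrite ge0_integralZr ?integral_indic ?setIT//.
  by apply/measurable_EFinP; exact: measurable_indic.
rewrite p12//.
(* The shear [(x, y) -> (x + y, y)] is a translation on each slice of constant [y], so invariance of
   [mu] applies slice by slice. *)
transitivity ((mu \x^ nu)%E E').
  apply: eq_integral => y _ /=.
  rewrite -(imu (- y)); last exact: measurable_ysection.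
  congr (mu _); apply/seteqP; split => x;
    rewrite /ysection /= !inE /E /E' /= subrK => -[];  split => //.
rewrite -p12// /product_measure1 /=.
rewrite (eq_integral (fun x =>
  (\1_B x)%:E * nu ((fun x : V => (- x)%R) @^-1` A))%E); last first.
  move=> x _ /=; rewrite indicE; have [xB|xB] := boolP (x \in B).
    rewrite mul1e -(inu x); last exact: measurable_xsection.
    congr (nu _); apply/seteqP; split => y;
    rewrite /xsection /= ?inE /E' /= opprD addrCA subrr addr0; first by case.
    by split => //; exact: set_mem.
  rewrite mul0e (_ : xsection _ x = set0) ?measure0//.
  apply/seteqP; split => y //; rewrite /xsection /= inE /E' /= => -[xA' _].
  by move: xB; rewrite mem_set.
rewrite ge0_integralZr ?integral_indic ?setIT//.
by apply/measurable_EFinP; exact: measurable_indic.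
Qed.

End haar.

Lemma mule_cancel (R : realType) (s : R) (a b : \bar R) :
  0 < s -> (s%:E * a = s%:E * b)%E -> a = b.
Proof.
move=> s0 e; apply/eqP; rewrite eq_le -(@lee_pmul2l _ s%:E)//.
by rewrite e lexx /= -(@lee_pmul2l _ s%:E)// e.
Qed.

(** * Lebesgue measure under involutive isometries fixing the origin *)

Section isometry.
Variables (R : realType) (n : nat).
Local Notation V := 'rV[R]_n.
Local Notation leb := (lebesgue_rV R n).

Lemma lebesgue_rV_cube (c r : R) : 0 < r ->
  exists2 s, 0 < s &
    leb [set x | forall i, `]c - r, c + r[%classic (x ord0 i)] = s%:E.
Proof.
move=> r0; rewrite (@lebesgue_rV_box R n (fun=> `]c - r, c + r[%classic))//.
elim/big_ind: _ => [|x y [s s0 ->] [t t0 ->]|i _].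
- by exists 1.
- by exists (s * t); rewrite ?mulr_gt0.
- exists (r *+ 2); first by rewrite pmulrn_lgt0.
  rewrite lebesgue_measure_itv /= lte_fin ifT; last by rewrite ltrD2l gtrN.
  by congr (_%:E); rewrite mulr2n; ring.
Qed.

Lemma continuous_dotvv : continuous (fun x : V => dotv x x).
Proof.
rewrite /dotv (_ : (fun _ => _) = \sum_(i < n)
  (fun x : V => x ord0 i * x ord0 i)); last first.
  by apply/funext => x; rewrite fct_sumE.
elim/big_ind: _ => [x|f g cf cg x|i _ x].
- exact: cst_continuous.
- exact: continuousD (cf x) (cg x).
- by apply: continuousM; exact: coord_continuous.
Qed.

Let ball1 := [set x : V | dotv x x < 1].

Let measurable_ball1 : measurable ball1.
Proof.
apply: open_measurable_rV.
rewrite (_ : ball1 = (fun x : V => dotv x x) @^-1` `]-oo, 1[%classic).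
  by move/continuousP: continuous_dotvv; apply; exact: interval_open.
by apply/seteqP; split => x /=; rewrite in_itv.
Qed.

(** The ball is squeezed between the cubes of half-side [1/(n+1)] and [1]. In the inner one
    [x_i^2 <= |x_i| <= 1/(n+1)], so the squares sum to at most [n/(n+1) < 1]. Positivity and
    finiteness will allow cancelling this measure. *)
Let ball1_fin : exists2 s, 0 < s & leb ball1 = s%:E.
Proof.
have m r :
    measurable [set x : V | forall i, `]0 - r, 0 + r[%classic (x ord0 i)].
  exact: (@measurable_box_rV R n (fun i => `]0 - r, 0 + r[%classic)).
pose c : R := n.+1%:R^-1.
have c0 : 0 < c by rewrite invr_gt0.
have [s s0 sE] := lebesgue_rV_cube 0 c0.
have [t t0 tE] := lebesgue_rV_cube 0 (@ltr01 R).
have sl : (s%:E <= leb ball1)%E.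
  rewrite -sE; apply: le_measure; [by rewrite inE; exact: m|by rewrite inE|].
  move=> x /= xc; rewrite /ball1 /= /dotv.
  apply: (@le_lt_trans _ _ (\sum_(i < n) c)).
    apply: ler_sum => i _.
    have := xc i; rewrite in_itv /= sub0r add0r -ltr_norml => xi.
    rewrite -expr2 -real_normK ?num_real// expr2.
    rewrite -[leRHS]mulr1; apply: ler_pM => //; first exact: ltW.
    by rewrite (le_trans (ltW xi))// /c invf_le1// ler1n.
  by rewrite sumr_const card_ord -mulr_natl /c ltr_pdivrMr// mul1r ltr_nat.
have tl : (leb ball1 <= t%:E)%E.
  rewrite -tE; apply: le_measure; [by rewrite inE|by rewrite inE; exact: m|].
  move=> x; rewrite /ball1 /= /dotv => x1 i.
  rewrite in_itv /= sub0r add0r -ltr_norml -(@ltr_pXn2r _ 2) ?nnegrE// expr1n.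
  rewrite real_normK ?num_real// expr2; apply: le_lt_trans x1.
  by rewrite (bigD1 i)//= lerDl sumr_ge0// => j _; rewrite -expr2 sqr_ge0.
case: (leb ball1) sl tl => [r||]//.
by rewrite !lee_fin => sr rt; exists r => //; apply: lt_le_trans sr.
Qed.

(** The image of [leb] under [S] is translation invariant and agrees with [leb] on the unit ball;
    [shift_invariant_swap], with that ball as second set, then determines it. *)
Lemma lebesgue_rV_isometry (S : V -> V) :
  measurable_fun setT S -> {morph S : x y / x + y} -> involutive S ->
  (forall x, dotv (S x) (S x) = dotv x x) ->
  forall A, measurable A -> leb (S @^-1` A) = leb A.
Proof.
move=> mS SD SS Sd A mA.
have sf : sigma_finite setT (pushforward leb S).
  have /sigma_finiteP[F [TF _ Foo]] := sigma_finiteT leb.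
  exists (fun k => S @^-1` F k).
    by rewrite -preimage_bigcup -TF preimage_setT.
  move=> k; have [mF ?] := Foo k; split; first exact: measurable_preimageT.
  rewrite /pushforward -comp_preimage (_ : S \o S = id)//.
  by apply/funext => x /=; rewrite SS.
have [m mE] : exists m : {sigma_finite_measure set V -> \bar R}, forall A,
  m A = leb (S @^-1` A).
  pose m0 : {measure set V -> \bar R} :=
    measure_function_pushforward__canonical__measure_function_Measure leb mS.
  pose m1 : {sigma_finite_measure set V -> \bar R} :=
    HB.pack (m0 : set V -> \bar R) (Measure.class m0)
    (Measure_isSigmaFinite.Build _ _ _ m0 sf).
  by exists m1.
have im : shift_invariant m.
  (* Pulled back through [S], the translation by [t] becomes the translation by [S t]. *)
  move=> t B mB; rewrite !mE -[RHS](lebesgue_rV_shift (S t));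
    last exact: measurable_preimageT.
  by congr (leb _); apply/seteqP; split => x /=; rewrite SD SS.
have il : shift_invariant leb by move=> t B; exact: lebesgue_rV_shift.
have [s s0 sE] := ball1_fin.
have mball : m ball1 = s%:E.
  rewrite mE -sE; congr (leb _).
  by apply/seteqP; split => x; rewrite /ball1 /= Sd.
have mN : m A = leb ((fun x : V => - x) @^-1` A).
  apply: (mule_cancel s0); rewrite [LHS]muleC.
  have := shift_invariant_swap im il mA measurable_ball1; rewrite sE mball.
  exact.
(* Comparing [leb] with itself removes the reflection through the origin left by the previous
   step. *)
have lN : leb A = leb ((fun x : V => - x) @^-1` A).
  apply: (mule_cancel s0); rewrite [LHS]muleC.
  have := shift_invariant_swap il il mA measurable_ball1; rewrite sE.
  exact.
by rewrite lN -mN mE.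
Qed.

End isometry.

(** * Smooth functions under affine maps *)

Section smooth.
Variables (R : realType) (n : nat).
Local Notation V := 'rV[R]_n.
Implicit Types (f g phi : V -> R) (M : 'M[R]_n) (t : V).

(** [smooth] is the largest class of differentiable functions stable under partial derivatives, so
    closure properties follow by exhibiting a stable class that contains the function. *)
Lemma smooth_coind (P : (V -> R) -> Prop) :
  (forall f, P f -> forall x, differentiable f x) ->
  (forall i f, P f -> P (partial i f)) ->
  forall f, P f -> smooth f.
Proof.
move=> Pd Pp f Pf s; suff : P (foldr (@partial R n) f s) by exact: Pd.
by elim: s => //= i s; exact: Pp.
Qed.

Lemma smooth_differentiable f : smooth f -> forall x, differentiable f x.
Proof. by move=> sf x; exact: (sf [::]). Qed.

Lemma smooth_partial i f : smooth f -> smooth (partial i f).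
Proof. by move=> sf s x; have := sf (rcons s i) x; rewrite foldr_rcons. Qed.

Lemma smooth_cst (c : R) : smooth (fun _ : V => c).
Proof.
apply: (@smooth_coind (fun f => exists c, f = cst c)); last by exists c.
  by move=> f [d ->] x; exact: differentiable_cst.
move=> i f [d ->]; exists 0; apply/funext => x.
by rewrite /partial derive_cst.
Qed.

Lemma partialD i f g x : differentiable f x -> differentiable g x ->
  partial i (fun x => f x + g x) x = partial i f x + partial i g x.
Proof.
move=> df dg; rewrite /partial -[X in 'D__ X _]/(f + g) deriveD//;
exact: diff_derivable.
Qed.

Lemma partialZ i (c : R) f x : differentiable f x ->
  partial i (fun x => c * f x) x = c * partial i f x.
Proof.
move=> df; rewrite /partial -[X in 'D__ X _]/(c \*: (f : V -> R^o)) deriveZ//.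
exact: diff_derivable.
Qed.

Lemma smoothD f g : smooth f -> smooth g -> smooth (fun x => f x + g x).
Proof.
move=> sf sg.
apply: (@smooth_coind
  (fun h => exists f g, [/\ smooth f, smooth g & h = fun x => f x + g x]));
  last by exists f, g.
  move=> h [{sf sg}f [{}g [sf sg ->]]] x.
  by apply: differentiableD; exact: smooth_differentiable.
move=> i h [{sf sg}f [{}g [sf sg ->]]].
exists (partial i f), (partial i g); split; [exact: smooth_partial..|].
by apply/funext => x; rewrite partialD//; exact: smooth_differentiable.
Qed.

Lemma smoothZ c f : smooth f -> smooth (fun x => c * f x).
Proof.
move=> sf.
apply: (@smooth_coind (fun h => exists2 f, smooth f & h = fun x => c * f x));
  last by exists f.
  move=> h [{sf}f sf ->] x.
  by apply: differentiableZ; exact: smooth_differentiable.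
move=> i h [{sf}f sf ->].
exists (partial i f); first exact: smooth_partial.
by apply/funext => x; rewrite partialZ//; exact: smooth_differentiable.
Qed.

Lemma smooth_sum m (F : 'I_m -> V -> R) : (forall j, smooth (F j)) ->
  smooth (fun x => \sum_(j < m) F j x).
Proof.
move=> sF; rewrite (_ : (fun _ => _) = \sum_(j < m) F j); last first.
  by apply/funext => x; rewrite fct_sumE.
elim/big_ind: _ => //; first exact: smooth_cst.
exact: smoothD.
Qed.

Definition affine M t (x : V) : V := x *m M + t.

Lemma differentiable_affine M t x : differentiable (affine M t) x.
Proof.
rewrite (_ : affine M t = (\sum_(j < n) (fun x : V => x ord0 j *: row j M)) +
  cst t); last first.
  apply/funext => y; rewrite /affine fctE fct_sumE; congr (_ + _).
  exact: mulmx_sum_row.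
apply: differentiableD; last exact: differentiable_cst.
apply: differentiable_sum => j; apply: differentiableZl.
exact: differentiable_coord.
Qed.

Lemma continuous_affine M t : continuous (affine M t).
Proof.
by move=> x; apply: differentiable_continuous;
  exact: differentiable_affine.
Qed.

(** Moving [x] along the [i]-th basis vector moves [affine M t x] along row [i] of [M], so the
    difference quotients coincide; linearity of the differential then expands the row. *)
Lemma partial_affine i M t f x : differentiable f (affine M t x) ->
  partial i (f \o affine M t) x = \sum_(j < n) M i j * partial j f
    (affine M t x).
Proof.
move=> df; transitivity ('D_(row i M) f (affine M t x)).
  rewrite /partial /derive.
  have -> // : (fun h : R =>
    h^-1 *: ((f \o affine M t \o shift x) (h *: delta_mx ord0 i) -
    (f \o affine M t) x)) =
    (fun h : R => h^-1 *:
      ((f \o shift (affine M t x)) (h *: row i M) - f (affine M t x))).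
  apply/funext => h /=; congr (_ *: (f _ - _)).
  by rewrite /affine mulmxDl -scalemxAl rowE addrA.
rewrite deriveE// [row i M]row_sum_delta linear_sum /=; apply: eq_bigr => j _.
by rewrite linearZ /= !mxE /partial deriveE.
Qed.

Lemma smooth_affine M t f : smooth f -> smooth (f \o affine M t).
Proof.
move=> sf.
apply: (@smooth_coind (fun h => exists2 f, smooth f & h = f \o affine M t));
  last by exists f.
  move=> h [{sf}f sf ->] x.
  apply: differentiable_comp; first exact: differentiable_affine.
  exact: smooth_differentiable.
move=> i h [{sf}f sf ->].
(* By the chain rule the partial derivative is again a smooth function composed with the same affine
   map. *)
exists (fun x => \sum_(j < n) M i j * partial j f x).
  by apply: smooth_sum => j; apply: smoothZ; exact: smooth_partial.
by apply/funext => x; rewrite partial_affine//; exact: smooth_differentiable.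
Qed.

Lemma smooth_continuous f : smooth f -> continuous f.
Proof.
by move=> sf x; apply: differentiable_continuous;
  exact: smooth_differentiable.
Qed.

(** Off the closed support [f] vanishes on a whole neighbourhood of [x], and a derivative depends
    only on the germ. *)
Lemma partial_support_eq0 i f x : ~ closure [set x | f x != 0] x ->
  partial i f x = 0.
Proof.
move=> Kx; rewrite /partial (@near_eq_derive _ _ _ f (cst 0)) ?derive_cst//.
have : nbhs x (~` closure [set x | f x != 0]).
  apply: open_nbhs_nbhs; split => //; exact/closed_openC/closed_closure.
apply: filterS => y /= Ky; apply/eqP; apply: contrapT => /negP fy.
by apply: Ky; exact: subset_closure.
Qed.

End smooth.

(** * Weak derivatives *)

Section test.
Variables (R : realType) (n : nat).
Local Notation V := 'rV[R]_n.
Local Notation leb := (lebesgue_rV R n).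
Implicit Types (f g u v phi psi : V -> R) (K : set V).

(** Continuity bounds [psi] by some [C] on the compact [K], so the product is dominated by [C |f|]
    restricted to [K]. *)
Lemma integrable_locally_integrable_mul f psi K : locally_integrable_rV f ->
  continuous psi -> compact K -> (forall x, ~ K x -> psi x = 0) ->
  leb.-integrable setT (EFin \o (fun x => f x * psi x)).
Proof.
move=> [mf lf] cpsi cK psi0.
have mK : measurable K by exact: compact_measurable_rV.
have [C Cpsi] : exists C, forall x, `|psi x| <= C.
  (* The extreme value theorem requires a nonempty [K]. *)
  have [K0|/set0P K0] := eqVneq K set0.
    by exists 0 => x; rewrite psi0 ?normr0// K0.
  have [c _ cP] : exists2 c, c \in K & forall x, x \in K ->
    `|psi x| <= `|psi c|.
    apply: EVT_max_rV => //; apply: continuous_subspaceT => x.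
    by apply: continuous_comp (cpsi x) _; exact: norm_continuous.
  exists `|psi c| => x; have [xK|xK] := pselect (K x); first by apply: cP;
    rewrite inE.
  by rewrite psi0// normr0.
have ifK : leb.-integrable setT ((EFin \o f) \_ K).
  rewrite -integrable_mkcond//; apply/integrableP; split; last exact: lf.
  by apply/measurable_EFinP; exact: measurable_funTS.
have mpsi : measurable_fun setT psi by exact: continuous_measurable_rV.
apply: (le_integrable measurableT _ _ (integrableZl measurableT C ifK)).
  by apply/measurable_EFinP; exact: measurable_funM.
move=> x _ /=; rewrite patchE; case: ifPn => [xK|].
  rewrite -EFinM !abse_EFin lee_fin !normrM mulrC.
  by rewrite ler_wpM2r// (le_trans (Cpsi x))// ler_norm.
by rewrite notin_setE => xK; rewrite psi0// mulr0 mule0.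
Qed.

Lemma test_mul_integrable f phi : locally_integrable_rV f ->
  test_function phi ->
  leb.-integrable setT (EFin \o (fun x => f x * phi x)).
Proof.
move=> lf [sphi cphi]; apply: integrable_locally_integrable_mul lf _ cphi _.
  exact: smooth_continuous.
move=> x Kx; apply/eqP; apply: contrapT => /negP phix; apply: Kx.
exact: subset_closure.
Qed.

Lemma test_partial_mul_integrable f phi i : locally_integrable_rV f ->
  test_function phi ->
  leb.-integrable setT (EFin \o (fun x => f x * partial i phi x)).
Proof.
move=> lf [sphi cphi]; apply: integrable_locally_integrable_mul lf _ cphi _.
  exact/smooth_continuous/smooth_partial.
by move=> x; exact: partial_support_eq0.
Qed.

(** Integrals against test functions are finite, so real-valued integrals can replace extended ones,
    and sums and signs raise no question of infinities. *)
Lemma weak_partialP i u g : locally_integrable_rV u ->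
  weak_partial i u g <-> locally_integrable_rV g /\
   forall phi, test_function phi ->
     Rintegral leb setT (fun x => u x * partial i phi x) = - Rintegral leb setT
       (fun x => g x * phi x).
Proof.
move=> lu; split => -[lg H]; split => // phi tphi.
  by rewrite /Rintegral H// fineN.
have Hu := integrable_fin_num measurableT
  (test_partial_mul_integrable i lu tphi).
have Hg := integrable_fin_num measurableT (test_mul_integrable lg tphi).
by rewrite -(fineK Hu) -(fineK Hg) -EFinN; congr EFin; exact: H.
Qed.

Lemma locally_integrable_rVP f : locally_integrable_rV f <->
  measurable_fun setT f /\ forall K, compact K -> leb.-integrable K (EFin \o f).
Proof.
split => -[mf H]; split => // K cK.
  apply/integrableP; split; last exact: H.
  by apply/measurable_EFinP; exact: measurable_funTS.
by have /integrableP[_] := H _ cK.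
Qed.

Lemma locally_integrable_rVD f g : locally_integrable_rV f ->
  locally_integrable_rV g ->
  locally_integrable_rV (fun x => f x + g x).
Proof.
move=> /locally_integrable_rVP[mf lf] /locally_integrable_rVP[mg lg].
apply/locally_integrable_rVP; split; first exact: measurable_funD.
move=> K cK; have mK := compact_measurable_rV cK.
by have := integrableD mK (lf _ cK) (lg _ cK).
Qed.

Lemma locally_integrable_rVZ c f : locally_integrable_rV f ->
  locally_integrable_rV (fun x => c * f x).
Proof.
move=> /locally_integrable_rVP[mf lf].
apply/locally_integrable_rVP; split; first exact: measurable_funM.
move=> K cK; have mK := compact_measurable_rV cK.
by have := integrableZl mK c (lf _ cK).
Qed.

Lemma locally_integrable_rV_sum m (F : 'I_m -> V -> R) :
  (forall j, locally_integrable_rV (F j)) ->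
  locally_integrable_rV (fun x => \sum_(j < m) F j x).
Proof.
move=> lF; rewrite (_ : (fun _ => _) = \sum_(j < m) F j); last first.
  by apply/funext => x; rewrite fct_sumE.
elim/big_ind: _ => //; last exact: locally_integrable_rVD.
apply/locally_integrable_rVP; split; first exact: measurable_cst.
by move=> K cK; apply: integrable0; exact: compact_measurable_rV.
Qed.

Lemma weak_partialD i u v g h : locally_integrable_rV u ->
  locally_integrable_rV v ->
  weak_partial i u g -> weak_partial i v h ->
  weak_partial i (fun x => u x + v x) (fun x => g x + h x).
Proof.
move=> lu lv /(weak_partialP _ _ lu)[lg ug] /(weak_partialP _ _ lv)[lh vh].
apply/weak_partialP; first exact: locally_integrable_rVD.
split => [|phi tphi]; first exact: locally_integrable_rVD.
under eq_Rintegral do rewrite mulrDl.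
rewrite RintegralD//; [|exact: test_partial_mul_integrable..].
rewrite ug// vh// -opprD; congr (- _).
under [RHS]eq_Rintegral do rewrite mulrDl.
by rewrite RintegralD//; exact: test_mul_integrable.
Qed.

Lemma weak_partialZ i c u g : locally_integrable_rV u ->
  weak_partial i u g -> weak_partial i (fun x => c * u x) (fun x => c * g x).
Proof.
move=> lu /(weak_partialP _ _ lu)[lg ug].
apply/weak_partialP; first exact: locally_integrable_rVZ.
split => [|phi tphi]; first exact: locally_integrable_rVZ.
under eq_Rintegral do rewrite -mulrA.
rewrite RintegralZl//; last exact: test_partial_mul_integrable.
rewrite ug// mulrN; congr (- _).
under [RHS]eq_Rintegral do rewrite -mulrA.
by rewrite RintegralZl//; exact: test_mul_integrable.
Qed.

End test.

(** * Affine involutive isometries *)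

Lemma LfunE d (X : measurableType d) (R : realType)
    (mu : {measure set X -> \bar R}) (p : \bar R) (g : X -> R) :
  g \in Lfun mu p <-> measurable_fun setT g /\ ('N[mu]_p[EFin \o g] < +oo)%E.
Proof.
split => [/andP[mg lg]|[mg lg]]; first by split; move: mg lg; rewrite !inE.
by apply/andP; split; rewrite inE.
Qed.

Section affine_reflection.
Variables (R : realType) (n : nat).
Local Notation V := 'rV[R]_n.
Local Notation leb := (lebesgue_rV R n).
Variables (M : 'M[R]_n) (t : V).
Hypotheses (MM : M *m M = 1%:M) (MT : M^T = M) (tM : t *m M = - t).
Local Notation T := (affine M t).
Implicit Types (u g phi : V -> R) (A K : set V).

(** [tM] puts [t] in the [-1] eigenspace of [M], which excludes glide reflections. *)
Lemma affineK : involutive T.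
Proof. by move=> x; rewrite /affine mulmxDl tM addrNK -mulmxA MM mulmx1. Qed.

Lemma dotvE (x y : V) : dotv x y = (x *m y^T) ord0 ord0.
Proof. by rewrite mxE; apply: eq_bigr => i _; rewrite mxE. Qed.

Lemma dotv_mulmx (x : V) : dotv (x *m M) (x *m M) = dotv x x.
Proof. by rewrite !dotvE trmx_mul MT -mulmxA (mulmxA M) MM mul1mx. Qed.

Lemma measurable_affine : measurable_fun [set: V] T.
Proof. by apply: continuous_measurable_rV2; exact: continuous_affine. Qed.

Lemma lebesgue_rV_affine A : measurable A -> leb (T @^-1` A) = leb A.
Proof.
move=> mA; rewrite -[RHS](lebesgue_rV_shift t)//.
rewrite -[RHS](@lebesgue_rV_isometry R n (fun x => x *m M)).
- by [].
- rewrite (_ : (fun _ => _) = affine M 0).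
    by apply: continuous_measurable_rV2; exact: continuous_affine.
  by apply/funext => x; rewrite /affine addr0.
- by move=> x y; rewrite mulmxDl.
- by move=> x; rewrite -mulmxA MM mulmx1.
- exact: dotv_mulmx.
- by apply: measurable_preimageT => //; exact: measurable_shift_rV.
Qed.

Lemma ge0_integral_affine K (f : V -> \bar R) : measurable K ->
  measurable_fun K f -> (forall x, K x -> 0 <= f x)%E ->
  (\int[leb]_(x in T @^-1` K) f (T x) = \int[leb]_(x in K) f x)%E.
Proof.
move=> mK mf f0; rewrite -(ge0_integral_pushforward measurable_affine)//.
  apply: eq_measure_integral => [|mT A mA _]; first exact: measurable_affine.
  exact: lebesgue_rV_affine.
by move=> x /set_mem; exact: f0.
Qed.

Lemma integrable_affine K (f : V -> \bar R) : measurable K ->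
  leb.-integrable K f -> leb.-integrable (T @^-1` K) (f \o T).
Proof.
move=> mK /integrableP[mf fi]; apply/integrableP; split.
  apply: (measurable_comp mK) => //.
    by move=> _ [x Kx <-].
  exact: (measurable_funS measurableT (@subsetT _ _) measurable_affine).
rewrite (_ : (\int[_]_(x in _) _ = \int[leb]_(x in K) `|f x|)%E)//.
by rewrite -[RHS]ge0_integral_affine//; exact: measurableT_comp.
Qed.

Lemma Rintegral_affine (F : V -> R) : leb.-integrable setT (EFin \o F) ->
  Rintegral leb setT (F \o T) = Rintegral leb setT F.
Proof.
move=> iF; rewrite /Rintegral; congr fine.
have mF : measurable_fun setT (EFin \o F) by case/integrableP: iF.
transitivity (\int[pushforward leb T]_x (EFin \o F) x)%E.
  rewrite (integral_pushforward measurable_affine)//.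
  by have := integrable_affine measurableT iF.
apply: eq_measure_integral => [|mT A mA _]; first exact: measurable_affine.
exact: lebesgue_rV_affine.
Qed.

(** A preimage under an involution is also an image, here a continuous image of a compact set. *)
Lemma compact_affine K : compact K -> compact (T @^-1` K).
Proof.
move=> cK; rewrite (_ : _ @^-1` _ = T @` K).
  by apply: continuous_compact => //; apply: continuous_subspaceT;
    exact: continuous_affine.
apply/seteqP; split => [x Kx|_ [x Kx <-]] /=; last by rewrite affineK.
by exists (T x) => //; rewrite affineK.
Qed.

Lemma locally_integrable_rV_affine u : locally_integrable_rV u ->
  locally_integrable_rV (u \o T).
Proof.
move=> /locally_integrable_rVP[mu lu]; apply/locally_integrable_rVP; split.
  by apply: measurableT_comp => //; exact: measurable_affine.
move=> K cK; rewrite (_ : K = T @^-1` (T @^-1` K)).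
  apply: (@integrable_affine (T @^-1` K) (EFin \o u)).
    by apply: compact_measurable_rV; exact: compact_affine.
  by apply: lu; exact: compact_affine.
by apply/seteqP; split => x /=; rewrite affineK.
Qed.

Lemma test_function_affine phi : test_function phi -> test_function (phi \o T).
Proof.
move=> [sphi cphi]; split; first exact: smooth_affine.
apply: (subclosed_compact _ (compact_affine cphi)); first exact: closed_closure.
have cl : closed (T @^-1` closure [set x | phi x != 0]).
  apply: closed_comp; last exact: closed_closure.
  by move=> x _; exact: continuous_affine.
rewrite closureE => x; apply; split => // y /= phiy.
exact: subset_closure.
Qed.

(** A change of variables moves [T] onto the test function: the equation for [u] is tested against
    [psi = phi \o T], and the chain rule for [phi = psi \o T] supplies the factor [M]. *)
Lemma weak_partial_affine u (Du : V -> V) :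
  locally_integrable_rV u ->
  (forall j, weak_partial j u (fun x => Du x ord0 j)) ->
  forall i, weak_partial i (u \o T) (fun x => (Du (T x) *m M) ord0 i).
Proof.
move=> lu wu i.
have lD j : locally_integrable_rV (fun x => Du x ord0 j) by have [] := wu j.
have gE : (fun x => (Du (T x) *m M) ord0 i) =
    (fun x => \sum_j M i j * Du x ord0 j) \o T.
  apply/funext => x /=; rewrite mxE; apply: eq_bigr => j _.
  (* Symmetry of [M] reconciles the column in the matrix product with the row in the chain rule. *)
  rewrite mulrC; congr (_ * _); by rewrite -{1}MT mxE.
have lg : locally_integrable_rV (fun x => \sum_j M i j * Du x ord0 j).
  by apply: locally_integrable_rV_sum => j; exact: locally_integrable_rVZ.
apply/weak_partialP; first exact: locally_integrable_rV_affine.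
split; first by rewrite gE; exact: locally_integrable_rV_affine.
move=> phi tphi.
pose psi := phi \o T.
have tpsi : test_function psi by exact: test_function_affine.
have spsi := smooth_differentiable tpsi.1.
have phiE : phi = psi \o T by apply/funext => x; rewrite /psi /= affineK.
have i1 j : leb.-integrable setT
  (EFin \o (fun x => M i j * (u x * partial j psi x))).
  by have := integrableZl measurableT (M i j)
    (test_partial_mul_integrable j lu tpsi).
have i2 j : leb.-integrable setT
  (EFin \o (fun x => M i j * (Du x ord0 j * psi x))).
  by have := integrableZl measurableT (M i j) (test_mul_integrable (lD j) tpsi).
rewrite [in LHS]phiE.
transitivity (Rintegral leb setT
  ((fun x => \sum_j M i j * (u x * partial j psi x)) \o T)).
  apply: eq_Rintegral => x _ /=; rewrite partial_affine// mulr_sumr.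
  by apply: eq_bigr => j _; rewrite mulrCA.
transitivity (- Rintegral leb setT
  ((fun x => \sum_j M i j * (Du x ord0 j * psi x)) \o T)); last first.
  congr (- _); apply: eq_Rintegral => x _ /=.
  have /= -> := congr1 (@^~ x) gE; rewrite mulr_suml.
  by apply: eq_bigr => j _; rewrite /psi /= affineK mulrA.
(* Integrability is carried along with the equality, since additivity demands it at each stage of
   the induction. *)
have Rint_sum (F : 'I_n -> V -> R) :
  (forall j, leb.-integrable setT (EFin \o F j)) ->
    leb.-integrable setT (EFin \o (fun x => \sum_j F j x)) /\
    Rintegral leb setT (fun x => \sum_j F j x) = \sum_j Rintegral leb setT
      (F j).
  move=> iF; rewrite (_ : (fun x => \sum_j F j x) = \sum_j F j); last first.
    by apply/funext => x; rewrite fct_sumE.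
  elim/big_ind2: _ => [|f a g b [iff <-] [ig <-]|//].
    split; first by rewrite (_ : _ \o _ = cst 0%E)//; exact: integrable0.
    by rewrite /Rintegral integral0_eq.
  by split; [exact: (integrableD measurableT iff ig)|rewrite -RintegralD].
have [I1 E1] := Rint_sum _ i1; have [I2 E2] := Rint_sum _ i2.
rewrite !Rintegral_affine// E1 E2 -sumrN; apply: eq_bigr => j _.
rewrite RintegralZl//; last exact: test_partial_mul_integrable.
rewrite RintegralZl//; last exact: test_mul_integrable.
by have /weak_partialP -/(_ lu) [_ ->] := wu j; rewrite ?mulrN.
Qed.

Lemma Lnorm_affine (p : R) (f : V -> R) : measurable_fun setT f ->
  ('N[leb]_(p%:E)[EFin \o (f \o T)] = 'N[leb]_(p%:E)[EFin \o f])%E.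
Proof.
move=> mf; rewrite unlock; congr (_ `^ _)%E.
rewrite -[RHS](ge0_integral_affine (K := setT))//.
  apply: measurableT_comp (@measurable_poweR R p) _.
  by apply: measurableT_comp => //; exact/measurable_EFinP.
by move=> x _; exact: poweR_ge0.
Qed.

Lemma Lfun_affine (p : R) g : g \in Lfun leb p%:E -> g \o T \in Lfun leb p%:E.
Proof.
move=> /LfunE[mg lg]; apply/LfunE; split; last by rewrite Lnorm_affine.
by apply: measurableT_comp => //; exact: measurable_affine.
Qed.

End affine_reflection.

(** * Strict convexity of [|.|^p] *)

Section strict_convexity.
Variable R : realType.
Implicit Types (p s t x : R).

Lemma powR_gt_tangent p x : 1 < p -> 0 <= x -> x != 1 ->
  1 + p * (x - 1) < x `^ p.
Proof.
(* [x^p = x e^((p-1) ln x)]; then use [1 + t < e^t] at [(p-1) ln x] and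
   [- ln x] *)
move=> p1; rewrite le_eqVlt => /predU1P[<- _|x0 x1].
  rewrite powR0; last by rewrite gt_eqF// (lt_trans _ p1).
  by rewrite sub0r mulrN1 subr_lt0.
have lx0 : ln x != 0 by rewrite ln_eq0.
have xp : x * expR ((p - 1) * ln x) = x `^ p.
  rewrite /powR gt_eqF// -[in LHS](lnK (x := x)) ?posrE//.
  by rewrite expRK -expRD; congr expR; ring.
have h1 : 1 + (p - 1) * ln x < expR ((p - 1) * ln x).
  by apply: expR_gt1Dx; rewrite mulf_neq0// subr_eq0 gt_eqF.
have h2 : 1 - ln x <= x^-1.
  by rewrite -[X in _ <= X^-1](lnK (x := x)) ?posrE// -expRN expR_ge1Dx.
have h3 : x * (1 - ln x) <= 1.
  by rewrite mulrC -ler_pdivlMr// div1r.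
rewrite -xp; apply: (@le_lt_trans _ _ (x * (1 + (p - 1) * ln x)));
  last by rewrite ltr_pM2l.
have : 0 <= (p - 1) * (1 - x * (1 - ln x)) by rewrite mulr_ge0// subr_ge0// ltW.
rewrite -subr_ge0 => h; rewrite -subr_ge0; apply: le_trans h _.
by rewrite le_eqVlt; apply/orP; left; apply/eqP; ring.
Qed.

(** Dividing by the midpoint [m] leaves two numbers with sum [2]; in the sum of their tangent bounds
    at [1] the linear terms cancel. *)
Lemma powR_midpoint_lt p s t : 1 < p -> 0 <= s -> 0 <= t -> s != t ->
  (2^-1 * (s + t)) `^ p < 2^-1 * (s `^ p + t `^ p).
Proof.
move=> p1 s0 t0 st.
pose m := 2^-1 * (s + t).
have m0 : 0 < m.
  rewrite mulr_gt0// lt_neqAle addr_ge0// andbT eq_sym.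
  apply: contra st; rewrite paddr_eq0// => /andP[/eqP -> /eqP ->]; exact: eqxx.
have mN0 : m != 0 by rewrite gt_eqF.
have ms : m * (s / m) = s by rewrite mulrCA mulfV// mulr1.
have mt : m * (t / m) = t by rewrite mulrCA mulfV// mulr1.
have sum2 : s / m + t / m = 2.
  by rewrite -mulrDl (_ : s + t = 2 * m) ?mulfK// /m; field.
(* If one quotient were [1], so would be the other, and [s = t]; hence both tangent bounds are
   strict. *)
have sm1 : s / m != 1.
  apply: contra st => /eqP sm; have tm : t / m = 1 by move: sum2; rewrite sm;
    lra.
  by rewrite -ms -mt sm tm.
have tm1 : t / m != 1.
  apply: contra sm1 => /eqP tm; apply/eqP; move: sum2; rewrite tm; lra.
have hs := powR_gt_tangent p1 (divr_ge0 s0 (ltW m0)) sm1.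
have ht := powR_gt_tangent p1 (divr_ge0 t0 (ltW m0)) tm1.
have h : 2 < (s / m) `^ p + (t / m) `^ p.
  apply: le_lt_trans (ltrD hs ht).
  rewrite addrACA -mulrDr (_ : s / m - 1 + (t / m - 1) = 0) ?mulr0 ?addr0//.
  by rewrite addrACA sum2; lra.
have es : s `^ p = m `^ p * (s / m) `^ p by rewrite -powRM ?divr_ge0 ?(ltW m0)//
  ms.
have et : t `^ p = m `^ p * (t / m) `^ p by rewrite -powRM ?divr_ge0 ?(ltW m0)//
  mt.
rewrite -/m es et -mulrDr mulrCA -[ltLHS]mulr1 ltr_pM2l ?powR_gt0//.
by move: h; lra.
Qed.

Variable n : nat.
Local Notation V := 'rV[R]_n.
Implicit Types a b : V.

Lemma dotvDl a b (c : V) : dotv (a + b) c = dotv a c + dotv b c.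
Proof. by rewrite !dotvE mulmxDl mxE. Qed.
Lemma dotvZl (k : R) a b : dotv (k *: a) b = k * dotv a b.
Proof. by rewrite !dotvE -scalemxAl mxE. Qed.
Lemma dotvC a b : dotv a b = dotv b a.
Proof. by apply: eq_bigr => i _; rewrite mulrC. Qed.
Lemma dotvDr a b (c : V) : dotv c (a + b) = dotv c a + dotv c b.
Proof. by rewrite !(dotvC c) dotvDl. Qed.
Lemma dotvZr (k : R) a b : dotv a (k *: b) = k * dotv a b.
Proof. by rewrite !(dotvC a) dotvZl. Qed.
Lemma dotvv_ge0 a : 0 <= dotv a a.
Proof. by apply: sumr_ge0 => i _; rewrite -expr2 sqr_ge0. Qed.
Lemma dotvv_eq0 a : (dotv a a == 0) = (a == 0).
Proof.
apply/eqP/eqP => [|->]; last by apply: big1 => i _; rewrite mxE mul0r.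
move/eqP; rewrite psumr_eq0 => [/allP a0|i _]; last by rewrite -expr2 sqr_ge0.
apply/rowP => i; rewrite mxE; apply/eqP; have := a0 i (mem_index_enum i).
by rewrite mulf_eq0 orbb.
Qed.
Lemma enorm_ge0 a : 0 <= enorm a.
Proof. exact: sqrtr_ge0. Qed.
Lemma sqr_enorm a : enorm a ^+ 2 = dotv a a.
Proof. by rewrite sqr_sqrtr// dotvv_ge0. Qed.
Lemma enorm_eq0 a : (enorm a == 0) = (a == 0).
Proof. by rewrite -sqrf_eq0 sqr_enorm dotvv_eq0. Qed.
Lemma enorm0 : enorm (0 : V) = 0.
Proof. by apply/eqP; rewrite enorm_eq0. Qed.
Lemma enormN a : enorm (- a) = enorm a.
Proof. by rewrite /enorm -scaleN1r dotvZl dotvZr !mulN1r opprK. Qed.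

Lemma cauchy_schwarz a b : dotv a b <= enorm a * enorm b.
Proof.
have [a0|a0] := eqVneq a 0.
  by rewrite a0 -(scale0r (0 : V)) dotvZl mul0r mulr_ge0 ?enorm_ge0.
have [b0|b0] := eqVneq b 0.
  by rewrite b0 -(scale0r (0 : V)) dotvZr mul0r mulr_ge0 ?enorm_ge0.
have sa : 0 < enorm a by rewrite lt_neqAle enorm_ge0 eq_sym enorm_eq0 a0.
have sb : 0 < enorm b by rewrite lt_neqAle enorm_ge0 eq_sym enorm_eq0 b0.
(* The squared length of [|b| a - |a| b] equals [2 |a| |b| (|a| |b| - a.b)], and its positive factor
   can be divided out. *)
have := dotvv_ge0 (enorm b *: a + (- enorm a) *: b).
rewrite dotvDl !dotvDr !dotvZl !dotvZr (dotvC b a) -!sqr_enorm.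
rewrite (_ : _ + _ = 2 * (enorm a * enorm b) * (enorm a * enorm b - dotv a b));
  last by ring.
by rewrite pmulr_rge0 ?subr_ge0// !mulr_gt0.
Qed.

Lemma ler_enorm_midpoint a b :
  enorm (2^-1 *: (a + b)) <= 2^-1 * (enorm a + enorm b).
Proof.
rewrite -(@ler_pXn2r _ 2) ?nnegrE ?mulr_ge0 ?addr_ge0 ?enorm_ge0//.
rewrite sqr_enorm dotvZl dotvZr mulrA -expr2 exprMn ler_pM2l ?exprn_gt0//.
rewrite dotvDl !dotvDr (dotvC b a) sqrrD -!sqr_enorm.
by have := cauchy_schwarz a b; lra.
Qed.

(** Strictness has two sources. If the lengths differ, it is strict convexity of [r^p]; if they
    agree, the midpoint lies strictly inside the sphere by the parallelogram law. *)
Lemma ltr_powR_enorm_midpoint p a b : 1 < p -> a != b ->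
  enorm (2^-1 *: (a + b)) `^ p < 2^-1 * (enorm a `^ p + enorm b `^ p).
Proof.
move=> p1 ab; have p0 : 0 < p by rewrite (lt_trans _ p1).
have mid0 : 0 <= 2^-1 * (enorm a + enorm b) by rewrite mulr_ge0// addr_ge0
  ?enorm_ge0.
have [eab|neab] := eqVneq (enorm a) (enorm b); last first.
  apply: le_lt_trans (powR_midpoint_lt p1 (enorm_ge0 a) (enorm_ge0 b) neab).
  by apply: ge0_ler_powR;
    rewrite ?nnegrE ?enorm_ge0 ?(ltW p0)// ler_enorm_midpoint.
rewrite -eab (_ : 2^-1 * (_ + _) = enorm a `^ p); last by field.
apply: gt0_ltr_powR; rewrite ?nnegrE ?enorm_ge0//.
rewrite -(@ltr_pXn2r _ 2) ?nnegrE ?enorm_ge0// !sqr_enorm.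
have : 0 < dotv (a - b) (a - b).
  by rewrite lt_neqAle dotvv_ge0 eq_sym dotvv_eq0 subr_eq0 ab.
have : dotv b b = dotv a a by rewrite -!sqr_enorm eab.
rewrite -scaleN1r dotvZl dotvZr !dotvDl !dotvDr !dotvZl !dotvZr (dotvC b a).
by move=> ->; lra.
Qed.

Lemma ler_powR_enorm_midpoint p a b : 1 < p ->
  enorm (2^-1 *: (a + b)) `^ p <= 2^-1 * (enorm a `^ p + enorm b `^ p).
Proof.
move=> p1; have [<-|ab] := eqVneq a b; last exact/ltW/ltr_powR_enorm_midpoint.
rewrite (_ : 2^-1 *: _ = a); first by rewrite le_eqVlt; apply/orP; left;
  apply/eqP; field.
by rewrite scalerDr -scalerDl (_ : 2^-1 + 2^-1 = 1) ?scale1r//; field.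
Qed.

End strict_convexity.

(** * The equality case of convexity for [L^p] norms of vector fields *)

Lemma mule_half (R : realType) (I : \bar R) : (0 <= I)%E -> (I < +oo)%E ->
  (2^-1%:E * (I + I) = I)%E.
Proof.
by case: I => // r _ _; rewrite -EFinD -EFinM; congr EFin; field.
Qed.

Lemma adde_eq_le (R : realType) (m h I : \bar R) :
  (m + h = I -> I <= m -> 0 <= h ->
  0 <= I -> I < +oo -> h = 0)%E.
Proof.
move=> <- mh h0; case: m mh => [m| |]; case: h h0 => [h| |] //.
by rewrite -EFinD !lee_fin gerDl => h0 h0' _ _; congr EFin; apply/eqP;
  rewrite eq_le h0 h0'.
Qed.

Section grad.
Variables (R : realType) (n : nat) (p : R).
Local Notation V := 'rV[R]_n.
Local Notation leb := (lebesgue_rV R n).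
Hypothesis p1 : 1 < p.
Implicit Types (u v : V -> R) (Du Dv a b : V -> V).

Let p0 : 0 < p. Proof. by rewrite (lt_trans _ p1). Qed.

Let pN0 : p != 0. Proof. by rewrite gt_eqF. Qed.

Definition measurable_field a :=
  forall i, measurable_fun [set: V] (fun x => a x ord0 i : R).

Lemma continuous_enorm : continuous (@enorm R n).
Proof.
move=> x; apply: continuous_comp (@continuous_dotvv R n x) _.
exact: sqrt_continuous.
Qed.

Lemma measurable_enorm a : measurable_field a ->
  measurable_fun setT (@enorm R n \o a).
Proof.
move=> ma; apply: measurableT_comp.
  exact: (continuous_measurable_rV continuous_enorm).
exact: measurable_fun_rV.
Qed.

Lemma measurable_powR_enorm a : measurable_field a ->
  measurable_fun setT (fun x => enorm (a x) `^ p).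
Proof.
by move=> ma; exact:
  (measurableT_comp (@measurable_powR R p) (measurable_enorm ma)).
Qed.

Lemma grad_norm_poweR a :
  (grad_norm p a `^ p = \int[leb]_x (enorm (a x) `^ p)%:E)%E.
Proof.
rewrite /grad_norm poweR_Lnorm//; apply: eq_integral => x _ /=.
by rewrite ger0_norm ?enorm_ge0.
Qed.

Lemma grad_norm_ge0 a : (0 <= grad_norm p a)%E.
Proof. exact: Lnorm_ge0. Qed.

(** The hypotheses on the norms force the pointwise convexity gap [h >= 0] to have integral zero. It
    vanishes almost everywhere, and strict convexity gives [a = b] there. *)
Lemma grad_norm_midpoint a b : measurable_field a -> measurable_field b ->
  (grad_norm p a < +oo)%E -> grad_norm p b = grad_norm p a ->
  (grad_norm p a <= grad_norm p (fun x => 2^-1 *: (a x + b x)))%E ->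
  grad_norm p (fun x => a x - b x) = 0%E.
Proof.
move=> ma mb fin_a ba le_mid.
pose mid x := 2^-1 *: (a x + b x).
have mmid : measurable_field mid.
  move=> i; rewrite (_ : (fun _ => _) = fun x =>
    2^-1 * (a x ord0 i + b x ord0 i)).
    by apply: measurable_funM => //; exact: measurable_funD.
  by apply/funext => x; rewrite !mxE.
have mab : measurable_field (fun x => a x - b x).
  move=> i; rewrite (_ : (fun _ => _) = fun x => a x ord0 i - b x ord0 i).
    exact: measurable_funB.
  by apply/funext => x; rewrite !mxE.
have mA := measurable_powR_enorm ma; have mB := measurable_powR_enorm mb.
have mM := measurable_powR_enorm mmid.
pose h x := 2^-1 * (enorm (a x) `^ p + enorm (b x) `^ p) - enorm (mid x) `^ p.
have h0 x : 0 <= h x by rewrite subr_ge0 ler_powR_enorm_midpoint.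
have mh : measurable_fun setT h.
  by apply: measurable_funB => //; apply: measurable_funM => //;
    exact: measurable_funD.
pose I_ := (\int[leb]_x (enorm (a x) `^ p)%:E)%E.
have Ifin : (I_ < +oo)%E by rewrite /I_ -grad_norm_poweR poweR_lty.
have I0 : (0 <= I_)%E by apply: integral_ge0 => x _; rewrite lee_fin powR_ge0.
have IB : (\int[leb]_x (enorm (b x) `^ p)%:E)%E = I_ by rewrite -grad_norm_poweR
  ba grad_norm_poweR.
have eA x : [set: V] x ->
  (0 <= (enorm (a x) `^ p)%:E)%E by rewrite lee_fin powR_ge0.
have eB x : [set: V] x ->
  (0 <= (enorm (b x) `^ p)%:E)%E by rewrite lee_fin powR_ge0.
have eM x : [set: V] x ->
  (0 <= (enorm (mid x) `^ p)%:E)%E by rewrite lee_fin powR_ge0.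
have eh x : [set: V] x -> (0 <= (h x)%:E)%E by rewrite lee_fin.
move/measurable_EFinP in mA; move/measurable_EFinP in mB;
  move/measurable_EFinP in mM.
move/measurable_EFinP in mh.
(* With the gap as a summand every integrand is nonnegative, so additivity requires only
   measurability. *)
have sumE : (\int[leb]_x (enorm (mid x) `^ p)%:E + \int[leb]_x (h x)%:E = I_)%E.
  rewrite -(ge0_integralD leb measurableT eM mM eh mh).
  transitivity (\int[leb]_x
    (2^-1%:E * ((enorm (a x) `^ p)%:E + (enorm (b x) `^ p)%:E)))%E.
    by apply: eq_integral => x _; rewrite -!EFinD -EFinM; congr EFin;
      rewrite /h addrC subrK.
  rewrite (ge0_integralZl_EFin leb measurableT).
  - by rewrite (ge0_integralD leb measurableT eA mA eB mB) IB; exact: mule_half.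
  - by move=> x _; rewrite -EFinD lee_fin addr_ge0 ?powR_ge0.
  - by apply: emeasurable_funD; [exact: mA|exact: mB].
  - by rewrite invr_ge0.
have midI : (I_ <= \int[leb]_x (enorm (mid x) `^ p)%:E)%E.
  rewrite -grad_norm_poweR /I_ -grad_norm_poweR;
    apply: gt0_ler_poweR (ltW p0) _ _ _ _ le_mid;
  by rewrite in_itv /= grad_norm_ge0 leey.
(* Cancellation is legitimate because [I_] is finite. *)
have Ih : (\int[leb]_x (h x)%:E = 0)%E.
  apply: adde_eq_le sumE midI _ I0 Ifin.
  by apply: integral_ge0 => x _; rewrite lee_fin.
have [ae_h _] := ae_eq_integral_abs leb measurableT mh.
have {}ae_h : ae_eq leb setT (EFin \o h) (cst 0%E).
  by apply: ae_h; rewrite -[RHS]Ih; apply: eq_integral => x _ /=;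
    rewrite ger0_norm.
(* It suffices that the [p]-th power of the norm vanishes, and this is an integral that ignores null
   sets. *)
apply: (poweR_eq0_eq0 (grad_norm_ge0 _) (r := p)); rewrite grad_norm_poweR.
have mabE := measurable_powR_enorm mab; move/measurable_EFinP in mabE.
transitivity (\int[leb]_x (cst 0%E x : \bar R))%E; last by rewrite integral0.
apply: (ae_eq_integral (cst 0%E) _ measurableT mabE (measurable_cst _)).
apply: filterS ae_h => x hx0 _; have /= [{}hx0] := hx0 I.
suff -> : a x = b x by rewrite subrr enorm0 powR0.
apply/eqP; apply: contrapT => /negP ab.
have := ltr_powR_enorm_midpoint p1 ab.
by rewrite -subr_gt0 -/(h x) hx0 ltxx.
Qed.

End grad.

(** * The space [D^{1,p}] and the extremals *)

(** An infinite factor times a positive one is infinite. Applied to the sharp constant and the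
    gradient norm, whose product is a finite positive seminorm. *)
Lemma mule_fin_factors (R : realType) (c g : \bar R) (q : R) :
  (c * g = q%:E -> 0 <= g -> 0 < c * g ->
  exists c' g' : R, [/\ c = c'%:E, g = g'%:E, (0 < c')%R & (0 < g')%R])%E.
Proof.
move=> cgq g0 cg0.
have gp : (0 < g)%E.
  by rewrite lt_neqAle g0 andbT; apply: contraTneq cg0 => <-;
    rewrite mule0 ltxx.
have cp : (0 < c)%E.
  rewrite ltNge; apply: contraTN cg0 => c0; rewrite -leNgt.
  exact: mule_le0_ge0.
case: g c cgq gp cp {g0 cg0} => [g| |] [c| |] //; last 2 first.
- by move=> + gp _; rewrite gt0_mulye.
- by move=> + _ cp; rewrite gt0_muley.
by move=> _ gp cp; exists c, g.
Qed.

Section D1p.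
Variables (R : realType) (n : nat) (p : R).
Local Notation V := 'rV[R]_n.
Local Notation leb := (lebesgue_rV R n).
Hypothesis p1 : 1 < p.
Implicit Types (u v : V -> R) (Du Dv : V -> V).

Let p1e : (1 <= p%:E)%E. Proof. by rewrite lee_fin ltW. Qed.

Lemma LfunD (f g : V -> R) : f \in Lfun leb p%:E -> g \in Lfun leb p%:E ->
  (fun x => f x + g x) \in Lfun leb p%:E.
Proof. by move=> lf lg; have [_] := Lfun_addr_closed leb p1e; apply. Qed.

Lemma LfunZ (c : R) (f : V -> R) : f \in Lfun leb p%:E ->
  (fun x => c * f x) \in Lfun leb p%:E.
Proof.
move=> lf; have := Lfun_scale c (ltW p1) lf.
by rewrite (_ : _ \o* _ = fun x => c * f x)//; apply/funext => x /=;
  rewrite mulrC.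
Qed.

Lemma Lfun_sum m (F : 'I_m -> V -> R) : (forall j, F j \in Lfun leb p%:E) ->
  (fun x => \sum_(j < m) F j x) \in Lfun leb p%:E.
Proof.
move=> lF; rewrite (_ : (fun _ => _) = \sum_(j < m) F j); last first.
  by apply/funext => x; rewrite fct_sumE.
elim/big_ind: _ => //; last exact: LfunD.
by have [] := Lfun_addr_closed leb p1e.
Qed.

Lemma D1p_gradD u v Du Dv : D1p_grad p u Du -> D1p_grad p v Dv ->
  D1p_grad p (fun x => u x + v x) (fun x => Du x + Dv x).
Proof.
move=> [cu lu du] [cv lv dv]; split.
- by move=> x; exact: continuousD (cu x) (cv x).
- exact: locally_integrable_rVD.
- move=> i; have [wu Lu] := du i; have [wv Lv] := dv i.
  rewrite (_ : (fun x => (Du x + Dv x) ord0 i) = fun x =>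
    Du x ord0 i + Dv x ord0 i).
    by split; [exact: weak_partialD|exact: LfunD].
  by apply/funext => x; rewrite mxE.
Qed.

Lemma D1p_gradZ c u Du : D1p_grad p u Du ->
  D1p_grad p (fun x => c * u x) (fun x => c *: Du x).
Proof.
move=> [cu lu du]; split.
- by move=> x; apply: continuousM (cu x); exact: cst_continuous.
- exact: locally_integrable_rVZ.
- move=> i; have [wu Lu] := du i.
  rewrite (_ : (fun x => (c *: Du x) ord0 i) = fun x => c * Du x ord0 i).
    by split; [exact: weak_partialZ|exact: LfunZ].
  by apply/funext => x; rewrite mxE.
Qed.

Lemma D1p_grad_measurable u Du : D1p_grad p u Du -> measurable_field Du.
Proof. by move=> [_ _ du] i; have [_ /LfunE[]] := du i. Qed.

(** * Action of affine reflections on [D^{1,p}] *)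

Section reflection.
Variables (M : 'M[R]_n) (t : V).
Hypotheses (MM : M *m M = 1%:M) (MT : M^T = M) (tM : t *m M = - t).
Local Notation T := (affine M t).

Lemma D1p_grad_affine u Du : D1p_grad p u Du ->
  D1p_grad p (u \o T) (fun x => Du (T x) *m M).
Proof.
move=> [cu lu du]; split.
- by move=> x; apply: continuous_comp (cu _); exact: continuous_affine.
- exact: locally_integrable_rV_affine.
- move=> i; split.
    by apply: weak_partial_affine => // j; have [] := du j.
  rewrite (_ : (fun x => _) = fun x => \sum_j M j i * Du (T x) ord0 j);
    last first.
    by apply/funext => x; rewrite mxE; apply: eq_bigr => j _; rewrite mulrC.
  apply: Lfun_sum => j; apply: LfunZ.
  have [_ Lu] := du j; exact: (Lfun_affine t MM MT Lu).
Qed.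

(** [T] preserves Lebesgue measure, and [M] preserves Euclidean length pointwise. *)
Lemma grad_norm_affine Du : measurable_field Du ->
  grad_norm p (fun x => Du (T x) *m M) = grad_norm p Du.
Proof.
move=> mDu; rewrite /grad_norm -(Lnorm_affine t MM MT p (measurable_enorm mDu)).
apply: eq_Lnorm => x /=; congr EFin; congr (Num.sqrt _).
exact: dotv_mulmx.
Qed.

End reflection.

Lemma grad_normN Du : grad_norm p (fun x => - Du x) = grad_norm p Du.
Proof. by apply: eq_Lnorm => x /=; rewrite enormN. Qed.

Lemma holder_quotient_le u x y : x != y ->
  ((holder_quotient p u x y)%:E <= holder_seminorm p u)%E.
Proof. by move=> xy; apply: ereal_sup_ubound; exists (x, y). Qed.

Lemma holder_quotient_denom_gt0 (x y : V) : x != y ->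
  0 < enorm (x - y) `^ (1 - n%:R / p).
Proof.
move=> xy; apply: powR_gt0.
by rewrite lt_neqAle enorm_ge0 eq_sym enorm_eq0 subr_eq0 xy.
Qed.

Lemma holder_seminorm_le0 u : (holder_seminorm p u <= 0)%E ->
  forall x y, u x = u y.
Proof.
move=> u0 x y; have [->//|xy] := eqVneq x y.
have := le_trans (holder_quotient_le u xy) u0.
rewrite lee_fin /holder_quotient pmulr_lle0 ?invr_gt0
  ?holder_quotient_denom_gt0//.
by rewrite normr_le0 subr_eq0 => /eqP.
Qed.

(* Junk values: if Morrey's inequality failed, [morrey_constant] would be [+oo]
   and only the constants would be extremal; so it need not be proved here. *)
Lemma extremal_morrey u x y : extremal p u ->
  holder_seminorm p u = (holder_quotient p u x y)%:E ->
  (forall x y, u x = u y) \/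
  exists c Du, [/\ 0 < c, D1p_grad p u Du, (grad_norm p Du < +oo)%E,
    holder_seminorm p u = (c%:E * grad_norm p Du)%E &
    forall v Dv, D1p_grad p v Dv ->
      (holder_seminorm p v <= c%:E * grad_norm p Dv)%E].
Proof.
move=> [Du Hu uE] qE.
have [u0|u0] := leP (holder_seminorm p u) 0%E.
  by left; exact: holder_seminorm_le0.
right; move: u0; rewrite uE => u0.
have [c [g [cE gE c0 g0]]] :=
  mule_fin_factors (etrans (esym uE) qE) (grad_norm_ge0 p Du) u0.
exists c, Du; split; rewrite ?gE ?cE ?ltry//.
move=> v Dv Hv.
have := grad_norm_ge0 p Dv; case kE : (grad_norm p Dv) => [k| |]//; last first.
  by move=> _; rewrite gt0_muley ?lte_fin// leey.
rewrite lee_fin le_eqVlt => /predU1P[k0|k0].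
  (* When the gradient norm is zero, division is impossible; but any admissible constant gives the
     bound [0], and one exists because the infimum is finite. *)
  have [C SC] : exists C : R, forall u Du, D1p_grad p u Du ->
      (holder_seminorm p u <= C%:E * grad_norm p Du)%E.
    apply/not_existsP => noC; move: cE; rewrite /morrey_constant.
    rewrite (_ : [set _ | _ in _] = set0) ?ereal_inf0//.
    by apply/seteqP; split => // z [C SC _]; exact: noC SC.
  by have := SC v Dv Hv; rewrite kE -k0 !mule0.
(* When it is positive, the seminorm divided by it is a lower bound of the admissible constants,
   hence at most their infimum. *)
rewrite -lee_pdivrMr// -cE; apply: le_ereal_inf_tmp => _ [C SC <-].
by rewrite lee_pdivrMr// -kE; exact: SC.
Qed.

End D1p.

(** * The reflection exchanging [x0] and [y0] *)

Lemma dotv_subZ (R : realType) n (a b : 'rV[R]_n) (c : R) :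
  dotv a (b - c *: a) = dotv a b - c * dotv a a.
Proof. by rewrite -scaleNr dotvDr dotvZr mulNr. Qed.

Section bisector.
Variables (R : realType) (n : nat) (x0 y0 : 'rV[R]_n).
Hypothesis hxy : x0 <> y0.
Local Notation e := (x0 - y0).
Local Notation m := (2^-1 *: (x0 + y0)).

(** The Householder matrix of the hyperplane orthogonal to [e]; vectors being rows, [e^T *m e] is
    the outer product. *)
Definition reflection_mx : 'M[R]_n := 1%:M - (2 / dotv e e) *: (e^T *m e).

(** Chosen so that the affine map fixes the midpoint [m]: its mirror is the perpendicular
    bisector. *)
Definition reflection_shift : 'rV[R]_n := m - m *m reflection_mx.

Let ee0 : dotv e e != 0.
Proof. by rewrite dotvv_eq0 subr_eq0; apply/eqP. Qed.

Lemma mulmx_reflection x :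
  x *m reflection_mx = x - (2 * (dotv e x / dotv e e)) *: e.
Proof.
rewrite mulmxBr mulmx1 -scalemxAr mulmxA; congr (_ - _).
rewrite (mx11_scalar (x *m e^T)) -dotvE mul_scalar_mx scalerA dotvC.
by congr (_ *: _); rewrite mulrAC mulrA.
Qed.

Lemma tr_reflection_mx : reflection_mx^T = reflection_mx.
Proof.
by rewrite /reflection_mx linearB /= trmx1 linearZ /= trmx_mul trmxK.
Qed.

Lemma reflection_mxK : reflection_mx *m reflection_mx = 1%:M.
Proof.
apply/row_matrixP => i; rewrite !rowE mulmxA mulmx1 !mulmx_reflection.
(* The reflection changes the sign of the scalar product with [e], so the two multiples of [e]
   cancel. *)
rewrite dotv_subZ -addrA -opprD -scalerDl.
rewrite (_ : 2 * _ + _ = 0) ?scale0r ?subr0//; field.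
exact: ee0.
Qed.

Lemma affine_reflection x : affine reflection_mx reflection_shift x =
  x - (2 * (dotv e (x - m) / enorm e ^+ 2)) *: e.
Proof.
rewrite /affine /reflection_shift addrCA -mulmxBl mulmx_reflection sqr_enorm.
by rewrite addrA (addrC m) subrK.
Qed.

Lemma affine_reflection_swap : affine reflection_mx reflection_shift x0 = y0 /\
  affine reflection_mx reflection_shift y0 = x0.
Proof.
have x0y0 : affine reflection_mx reflection_shift x0 = y0.
  (* Since [x0 - m] is half of [e], the coefficient of [e] is [1], and [x0 - e = y0]. *)
  rewrite affine_reflection sqr_enorm (_ : x0 - m = 2^-1 *: e); last first.
    by apply/rowP => i; rewrite !mxE; field.
  rewrite dotvZr (_ : 2 * _ = 1) ?scale1r ?subKr//; field.
  exact: ee0.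
split=> //; rewrite -[in LHS]x0y0 affineK//.
- exact: reflection_mxK.
- by rewrite /reflection_shift mulmxBl -mulmxA reflection_mxK mulmx1 opprB.
Qed.

End bisector.

(** * Antisymmetry of extremals about the bisector *)

Theorem proposition3p4 (R : realType) (n : nat) (p : R)
  (hn : (1 <= n)%N) (hp : n%:R < p)
  (x0 y0 : 'rV[R]_n) (hxy : x0 <> y0)
  (u : 'rV[R]_n -> R) (hu : extremal p u)
  (hsup : holder_seminorm p u = (holder_quotient p u x0 y0)%:E) :
  forall x : 'rV[R]_n,
    u (x - (2 * (dotv (x0 - y0) (x - 2^-1 *: (x0 + y0))
                 / enorm (x0 - y0) ^+ 2)) *: (x0 - y0))
      - (u x0 + u y0) / 2
    = - (u x - (u x0 + u y0) / 2).
Proof.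
have p1 : 1 < p by apply: le_lt_trans hp; rewrite ler1n.
move=> x; rewrite -affine_reflection//.
have [const|[c [Du [c0 Hu gfin uE Hm]]]] := extremal_morrey hu hsup.
  by rewrite (const (affine _ _ _) x0) (const x x0) (const y0 x0); field.
set M := reflection_mx x0 y0; set t := reflection_shift x0 y0.
have MM : M *m M = 1%:M by exact: reflection_mxK.
have MT : M^T = M by exact: tr_reflection_mx.
have [Tx0 Ty0] := affine_reflection_swap hxy.
have tM : t *m M = - t by rewrite mulmxBl -mulmxA MM mulmx1 opprB.
pose Du' x := Du (affine M t x) *m M.
have Hu' : D1p_grad p (u \o affine M t) Du' by exact: D1p_grad_affine.
(* This is [w = (u - u \o T) / 2], written so that its gradient is the midpoint of [Du] and
   [- Du']. *)
have Hw := D1p_gradZ p1 2^-1 (D1p_gradD p1 Hu (D1p_gradZ p1 (-1) Hu')).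
have mDu := D1p_grad_measurable Hu.
have mDu' := D1p_grad_measurable (D1p_gradZ p1 (-1) Hu').
have gDu' : grad_norm p (fun x => -1 *: Du' x) = grad_norm p Du.
  rewrite -(grad_norm_affine p t MM MT mDu) -[RHS]grad_normN.
  by congr (grad_norm p _); apply/funext => z; rewrite scaleN1r.
have le_mid : (grad_norm p Du <= grad_norm p
  (fun x => 2^-1 *: (Du x + -1 *: Du' x)))%E.
  (* As [c] is finite and positive, the norms may be compared after multiplication by it. [T] swaps
     [x0] and [y0], so [w] has there the same quotient as [u], namely the seminorm of [u]. *)
  rewrite -(@lee_pmul2l _ c%:E)// -uE; apply: le_trans (Hm _ _ Hw).
  rewrite hsup; apply: le_trans (holder_quotient_le _ _ (introN eqP hxy)).
  by rewrite /holder_quotient /= Tx0 Ty0 (_ : 2^-1 * _ - _ = u x0 - u y0)//;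
    field.
(* The difference of the two fields is [Du + Du'], the gradient of [u + u \o T]. *)
have g0 := grad_norm_midpoint p1 mDu mDu' gfin gDu' le_mid.
have Hd := D1p_gradD p1 Hu Hu'.
have d0 : (holder_seminorm p (fun x => u x + (u \o affine M t) x)%R <= 0)%E.
  apply: le_trans (Hm _ _ Hd) _; rewrite (_ : grad_norm p _ = 0%E) ?mule0//.
  by rewrite -[RHS]g0; congr (grad_norm p _); apply/funext => z;
    rewrite scaleN1r opprK.
have := holder_seminorm_le0 d0 x x0; rewrite /= Tx0 => dE.
rewrite (_ : u (affine M t x) = u x0 + u y0 - u x); first by field.
by rewrite -dE addrC addKr.
Qed.
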